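(* Let $n\geq 1$, let $\langle c^{\mathrm{out}},c^{\mathrm{in}}\rangle$ be a cell-wing of dimension $n-1$ of $\mathsf{CC}(n)$, and set $c:=\Gamma\langle c^{\mathrm{out}},c^{\mathrm{in}}\rangle$. Then $$\mathrm{vol}\langle c^{\mathrm{out}},c^{\mathrm{in}}\rangle=\mathrm{sv}(c).$$
   Context: For integers $i,j$, $[i,j]=\{i,i+1,\dots,j\}$ and $[i]=[1,i]$. A Tamari diagram of size $n$ is a word $u$ of length $n$ on $\mathbb{N}=\{0,1,2,\dots\}$ such that $0\leq u_i\leq n-i$ for all $i\in[n]$ and $u_{i+j}\leq u_i-j$ for all $i\in[n]$, $j\in[0,u_i]$. A dual Tamari diagram of size $n$ is a word $v$ of length $n$ on $\mathbb{N}$ such that $0\leq v_i\leq i-1$ for all $i\in[n]$ and $v_{i-j}\leq v_i-j$ for all $i\in[n]$, $j\in[0,v_i]$. They are compatible if there are no $1\leq i<j\leq n$ with $u_i\geq j-i$ and $v_j\geq j-i$. A Tamari interval diagram of size $n$ is a pair $(u,v)$ of compatible Tamari and dual Tamari diagrams of size $n$. A cubic coordinate of size $n$ is an $(n-1)$-tuple of integers of the form $(u_1-v_2,\dots,u_{n-1}-v_n)$ with $(u,v)$ a Tamari interval diagram of size $n$; $\mathsf{CC}(n)$ is the set of these, ordered by $c\preccurlyeq c'$ iff $c_i\leq c'_i$ for all $i\in[n-1]$. A cubic coordinate $c$ is synchronized if $c_i\neq 0$ for all $i\in[n-1]$; $\mathsf{SCC}(n)$ is the set of these. For $c\in\mathsf{CC}(n)$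 and $i\in[n-1]$, $\uparrow_i(c)$ denotes the element of $\mathsf{CC}(n)$ that covers $c$ and differs from $c$ only at index $i$, when such an element exists (it is then unique). By convention $\uparrow_n(c)=c$. An output-wing is an element $c\in\mathsf{CC}(n)$ covered by exactly $n-1$ elements (equivalently, $\uparrow_i(c)$ exists for all $i\in[n-1]$). For an output-wing $c$, its corresponding input-wing is $\uparrow_1(\uparrow_2(\cdots(\uparrow_{n-1}(\uparrow_n(c)))\cdots))$, which is a well-defined cubic coordinate. For $c\preccurlyeq c'$ in $\mathsf{CC}(n)$, the cell $\langle c,c'\rangle$ is $\{x\in\mathbb{R}^{n-1}: c_i\leq x_i\leq c'_i \text{ for all } i\in[n-1]\}$, and its dimension is the number of indices $d$ with $c_d\neq c'_d$. A cell-wing is a cell $\langle c^{\mathrm{out}},c^{\mathrm{in}}\rangle$ where $c^{\mathrm{out}}$ is an output-wing and $c^{\mathrm{in}}$ is its corresponding input-wing. The volume of a cell-wing of dimension $n-1$ is $\mathrm{vol}\langle c^{\mathrm{out}},c^{\mathrm{in}}\rangle=\prod_{i=1}^{n-1}(c^{\mathrm{in}}_i-c^{\mathrm{out}}_i)$. For a cell-wing $\langle c^{\mathrm{out}},c^{\mathrm{in}}\rangle$ of dimension $n-1$, $\Gamma\langle c^{\mathrm{out}},c^{\mathrm{in}}\rangle$ is the $(n-1)$-tuple whose $i$-th component is $c^{\mathrm{out}}_i$ if $c^{\mathrm{out}}_i<0$ and $c^{\mathrm{in}}_i$ if $c^{\mathrm{out}}_i\geq 0$; it is an element of $\mathsf{SCC}(n)$.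 On $\mathsf{SCC}(n)$ define the partial order $c'\preccurlyeq_{\mathrm s}c$ if, for every $i\in[n-1]$, $c'_i$ and $c_i$ have the same sign and $|c'_i|\leq|c_i|$. For $c\in\mathsf{SCC}(n)$, put $\mathrm{vol}\langle c\rangle=\prod_{i=1}^{n-1}|c_i|$, and define the synchronized volume recursively by $$\mathrm{sv}(c):=\mathrm{vol}\langle c\rangle-\sum_{c'\in\mathsf{SCC}(n),\ c'\preccurlyeq_{\mathrm s}c,\ c'\neq c}\mathrm{sv}(c').$$ *)

(* Defs.v *)
From mathcomp Require Import all_boot all_order all_algebra.
From mathcomp Require Import finmap zify.

Set Implicit Arguments.
Unset Strict Implicit.
Unset Printing Implicit Defensive.

Import Order.TTheory GRing.Theory Num.Theory.
Local Open Scope ring_scope.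
Local Open Scope fset_scope.

(* A word of length n on the natural numbers is a function 'I_n -> nat.
   Positions are 0-based: i : 'I_n is the usual position i + 1. *)

(* Below, k plays the role of i + j (resp. i - j), with j ranging over
   [0, u_i] (resp. [0, v_i]). *)
Definition tamari_diagram n (u : 'I_n -> nat) : bool :=
  [forall i : 'I_n, u i <= n - i.+1]%N &&
  [forall i : 'I_n, forall k : 'I_n,
     (i <= k <= i + u i)%N ==> (u k <= u i - (k - i))%N].

Definition dual_tamari_diagram n (v : 'I_n -> nat) : bool :=
  [forall i : 'I_n, v i <= i]%N &&
  [forall i : 'I_n, forall k : 'I_n,
     (k <= i <= k + v i)%N ==> (v k <= v i - (i - k))%N].

Definition compatible n (u v : 'I_n -> nat) : bool :=
  ~~ [exists i : 'I_n, exists j : 'I_n,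
        [&& i < j, j - i <= u i & j - i <= v j]%N].

Definition tamari_interval_diagram n (u v : 'I_n -> nat) : bool :=
  [&& tamari_diagram u, dual_tamari_diagram v & compatible u v].

(* From here on the size is m.+1, so that coordinates are indexed by 'I_m. *)

Definition cubic_of m (u v : 'I_m.+1 -> nat) : {ffun 'I_m -> int} :=
  [ffun i : 'I_m => (u (widen_ord (leqnSn m) i))%:Z - (v (lift ord0 i))%:Z].

(* The letters of Tamari and dual Tamari diagrams of size n are less than n,
   so enumerating the words on 'I_n is enough; see CCP. *)
Definition CC m : {fset {ffun 'I_m -> int}} :=
  let W := {ffun 'I_m.+1 -> 'I_m.+1} in
  let word (w : W) (i : 'I_m.+1) : nat := w i in
  [fset cubic_of (word p.1) (word p.2)
    | p in [pred p : W * W | tamari_interval_diagram (word p.1) (word p.2)]].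

Definition SCC m : {fset {ffun 'I_m -> int}} :=
  [fset c in CC m | [forall i, c i != 0]].

Definition cc_le m (c c' : {ffun 'I_m -> int}) : bool :=
  [forall i, c i <= c' i].

Definition cc_covers m (c c' : {ffun 'I_m -> int}) : bool :=
  [&& c \in CC m, c' \in CC m, cc_le c c', c != c' &
      ~~ has (fun d => [&& cc_le c d, cc_le d c', d != c & d != c']) (CC m)].

Definition differs_only_at m (i : 'I_m) (c c' : {ffun 'I_m -> int}) : bool :=
  [forall j, (c j != c' j) == (j == i)].

(* The partial map c |-> \uparrow_i(c); see up_SomeP and up_NoneP. *)
Definition up m (i : 'I_m) (c : {ffun 'I_m -> int}) :
    option {ffun 'I_m -> int} :=
  ohead [seq c' <- CC m | cc_covers c c' && differs_only_at i c c'].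

Definition output_wing m (c : {ffun 'I_m -> int}) : bool :=
  (c \in CC m) && (#|` [fset c' in CC m | cc_covers c c'] | == m)%N.

(* Applies up at the last index first, and at index 0 last. *)
Definition input_wing m (c : {ffun 'I_m -> int}) :
    option {ffun 'I_m -> int} :=
  foldr (fun i oc => obind (up i) oc) (Some c) (enum 'I_m).

(* A cell is given by its pair of extreme points, which determine it. *)
Definition is_cell m (c c' : {ffun 'I_m -> int}) : bool :=
  [&& c \in CC m, c' \in CC m & cc_le c c'].

Definition cell_dim m (c c' : {ffun 'I_m -> int}) : nat :=
  #|[set d | c d != c' d]|.

Definition cell_wing m (cout cin : {ffun 'I_m -> int}) : Prop :=
  [/\ is_cell cout cin, output_wing cout & input_wing cout = Some cin].

Definition cell_vol m (cout cin : {ffun 'I_m -> int}) : int :=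
  \prod_(i < m) (cin i - cout i).

Definition Gamma m (cout cin : {ffun 'I_m -> int}) : {ffun 'I_m -> int} :=
  [ffun i => if cout i < 0 then cout i else cin i].

Definition scc_le m (c' c : {ffun 'I_m -> int}) : bool :=
  [forall i, (sgz (c' i) == sgz (c i)) && (`|c' i| <= `|c i|)].

Definition vol m (c : {ffun 'I_m -> int}) : int := \prod_(i < m) `|c i|.

(* sv is the recursion of lemma svE, run with enough fuel: the sum of the
   |c_i| strictly decreases at each call. *)
Fixpoint sv_rec m (k : nat) (c : {ffun 'I_m -> int}) : int :=
  if k is k'.+1 then
    vol c - \sum_(c' <- SCC m | scc_le c' c && (c' != c)) sv_rec k' c'
  else 0.

Definition absz_sum m (c : {ffun 'I_m -> int}) : nat := (\sum_i `|c i|)%N.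

Definition sv m (c : {ffun 'I_m -> int}) : int := sv_rec (absz_sum c).+1 c.

Lemma CCP m (c : {ffun 'I_m -> int}) :
  reflect (exists u v : 'I_m.+1 -> nat,
             tamari_interval_diagram u v /\ c = cubic_of u v)
          (c \in CC m).
Proof.
apply: (iffP idP) => [/imfsetP[[u v] /= uvP ->]|[u [v [uvP ->]]]].
  by exists (fun i => u i : nat), (fun i => v i : nat).
apply/imfsetP.
have ult i : (u i < m.+1)%N.
  case/and3P: uvP => /andP[/forallP/(_ i) ui _] _ _.
  by rewrite ltnS (leq_trans ui)// subSS leq_subr.
have vlt i : (v i < m.+1)%N.
  case/and3P: uvP => _ /andP[/forallP/(_ i) vi _] _.
  exact: leq_ltn_trans vi (ltn_ord i).
pose p := ([ffun i => Ordinal (ult i)], [ffun i => Ordinal (vlt i)]).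
have p1 i : (p.1 i : nat) = u i by rewrite ffunE.
have p2 i : (p.2 i : nat) = v i by rewrite ffunE.
exists p; last by apply/ffunP => i; rewrite [LHS]ffunE [RHS]ffunE -p1 -p2.
rewrite /in_mem /=; case/and3P: uvP => /andP[u1 u2] /andP[v1 v2] uv.
apply/and3P; split; [apply/andP; split|apply/andP; split|].
- by apply/forallP => i; rewrite p1; apply: (forallP u1).
- apply/forallP => i; apply/forallP => k; rewrite !p1.
  exact: (forallP (forallP u2 i) k).
- by apply/forallP => i; rewrite p2; apply: (forallP v1).
- apply/forallP => i; apply/forallP => k; rewrite !p2.
  exact: (forallP (forallP v2 i) k).
- apply: contra uv => /existsP[i /existsP[j]]; rewrite p1 p2 => ij.
  by apply/existsP; exists i; apply/existsP; exists j.
Qed.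

Lemma cc_covers_only_uniq m (i : 'I_m) (c c1 c2 : {ffun 'I_m -> int}) :
  cc_covers c c1 -> differs_only_at i c c1 ->
  cc_covers c c2 -> differs_only_at i c c2 -> c1 = c2.
Proof.
wlog le12 : c1 c2 / c1 i <= c2 i => [H cv1 d1 cv2 d2|].
  by case/orP: (le_total (c1 i) (c2 i)) => le; [|symmetry]; apply: H.
case/and5P=> _ c1C cc1 nc1 _ /forallP d1 /and5P[_ _ _ _ /hasPn h] /forallP d2.
have := h _ c1C; rewrite cc1 (eq_sym c1 c) nc1 /= negb_and negbK.
have -> /= : cc_le c1 c2.
  apply/forallP => j; have [->//|ji] := eqVneq j i.
  move: (d1 j) (d2 j); rewrite (negbTE ji) => /eqP/negbFE/eqP <-.
  by move=> /eqP/negbFE/eqP <-.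
by move/eqP.
Qed.

Lemma up_SomeP m (i : 'I_m) (c c' : {ffun 'I_m -> int}) :
  up i c = Some c' <-> cc_covers c c' /\ differs_only_at i c c'.
Proof.
rewrite /up; split=> [|[cv df]].
  case E: [seq _ <- _ | _] => [//|d s] /= [<-].
  have : d \in d :: s by rewrite inE eqxx.
  by rewrite -E mem_filter => /andP[/andP[]].
have : c' \in [seq c' <- CC m | cc_covers c c' && differs_only_at i c c'].
  by rewrite mem_filter cv df /=; case/and5P: cv.
case E: [seq _ <- _ | _] => [//|d s] _ /=.
have : d \in d :: s by rewrite inE eqxx.
rewrite -E mem_filter => /andP[/andP[cvd dfd] _].
by congr Some; apply: cc_covers_only_uniq cvd dfd cv df.
Qed.

Lemma up_NoneP m (i : 'I_m) (c : {ffun 'I_m -> int}) :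
  up i c = None <-> ~ exists c', cc_covers c c' /\ differs_only_at i c c'.
Proof.
split=> [E [c' /up_SomeP]|H]; first by rewrite E.
by case E: (up i c) => [c'|//]; case: H; exists c'; apply/up_SomeP.
Qed.

Lemma scc_lt_absz_sum m (c' c : {ffun 'I_m -> int}) :
  scc_le c' c -> c' != c -> (absz_sum c' < absz_sum c)%N.
Proof.
move=> /forallP le; apply: contraNltn => ge; apply/eqP/ffunP => i.
have leN j : (`|c' j| <= `|c j|)%N by case/andP: (le j) => _; lia.
have : (absz_sum c' == absz_sum c)%N.
  by rewrite eqn_leq ge andbT; apply: leq_sum => j _; apply: leN.
have /leqif_sum/= H : forall j : 'I_m, true ->
    (`|c' j| <= `|c j| ?= iff (`|c' j| == `|c j|))%N.
  by move=> j _; split.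
rewrite /absz_sum H => /forallP/(_ i)/eqP E.
case/andP: (le i) => /eqP sg _.
by rewrite [LHS]intEsg [RHS]intEsg sg E.
Qed.

Lemma sv_rec_fuel m k l (c : {ffun 'I_m -> int}) :
  (absz_sum c < k)%N -> (absz_sum c < l)%N -> sv_rec k c = sv_rec l c.
Proof.
elim: k l c => [//|k IH] [//|l] c ck cl /=; congr (_ - _).
apply: eq_bigr => c' /andP[le ne]; have lt := scc_lt_absz_sum le ne.
by apply: IH; apply: leq_trans lt _.
Qed.

Lemma svE m (c : {ffun 'I_m -> int}) :
  sv c = vol c - \sum_(c' <- SCC m | scc_le c' c && (c' != c)) sv c'.
Proof.
rewrite {1}/sv /=; congr (_ - _).
apply: eq_bigr => c' /andP[le ne].
exact: sv_rec_fuel (scc_lt_absz_sum le ne) (ltnSn _).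
Qed.

(* Main.v *)
Require Import Defs.
From mathcomp Require Import all_boot all_order all_algebra.
From mathcomp Require Import finmap zify.

Set Implicit Arguments.
Unset Strict Implicit.
Unset Printing Implicit Defensive.

Import Order.TTheory GRing.Theory Num.Theory.
Local Open Scope ring_scope.

(** The synchronized volume counts unit cubes.  Fix a synchronized cubic
coordinate c and look at the box between the origin and c, cut into unit
cubes.  The synchronized coordinates below c for the order [scc_le] are closed
under the meet that keeps the entry of smaller absolute value, so every unit
cube of the box lies in the box of a least synchronized coordinate.  Grouping
the cubes by this coordinate gives vol c = sum of #own_cells d over d below c,
which is the recursion that defines [sv]; hence sv c = #own_cells c
([sv_card]), where [own_cells c] consists of the cubes whose least
coordinate is c itself.

It remains to see that, for c = Gamma a b with (a, b) an output-wing and its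
input-wing, the cubes of [own_cells c] are exactly those between a and b
([own_cells_Gamma]); a box of unit cubes is then counted by the product of its
sides.  The cubes of [own_cells c] have to avoid the boxes
of the coordinates obtained from c by replacing a single entry by the other
end of the interval between a_i and b_i, since these are cubic
([Gamma_shrink]).
Conversely a cubic coordinate d that in every entry is strictly beyond that
other end, but not beyond c, equals c ([Gamma_unique]): the entries of b were
built one after the other, from the last index to the first, each being the
least possible increase over the entry of a, and the entries of d are possible
increases too.

That Gamma a b is a cubic coordinate ([Gamma_cubic]) comes down to the
compatibility of the nonnegative part of b with the negative part of a
([wing_compat]).  This is where a being an output-wing matters: every entry of
a can be increased on its own, and the least T that reaches at least as far as
such an increase and as the intervals of b starting in it stays clear of the
negative entries of a. *)

(** * Cubic coordinates described by their entries *)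

(** With 0-based coordinates, u_i is the positive part of c_i, while the letter
of v at position i + 1 is the negative part of c_i; so i + c_i is the last
position covered by the letter u_i when c_i is positive, and one less than the
first position covered by that letter of v when c_i is negative. *)
Definition compat_pair m (c : {ffun 'I_m -> int}) (i k : 'I_m) : Prop :=
  ~ (k%:Z < i%:Z + c i /\ k%:Z + c k < i%:Z).

(** The first half is the Tamari condition and the second the dual one.  Signs
need not be tested: the first premise forces c_i > 0 and its conclusion is
trivial unless c_k > 0, the second forces c_k < 0 and its conclusion is trivial
unless c_i < 0. *)
Definition nested_pair m (c : {ffun 'I_m -> int}) (i k : 'I_m) : Prop :=
  (k%:Z <= i%:Z + c i -> k%:Z + c k <= i%:Z + c i) /\
  (k%:Z + c k <= i%:Z -> k%:Z + c k <= i%:Z + c i).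

Definition cubic m (c : {ffun 'I_m -> int}) : Prop :=
  (forall i : 'I_m, -1 <= i%:Z + c i <= m%:Z) /\
  (forall i k : 'I_m, (i < k)%N -> nested_pair c i k /\ compat_pair c i k).

(** Compatibility at adjacent positions says that u_i and the letter of v at
i + 1 are not both nonzero, so c determines u and v as positive and negative
parts. *)
Lemma CC_cubic m (c : {ffun 'I_m -> int}) : c \in CC m <-> cubic c.
Proof.
split=> [/CCP[u [v [/and3P[/andP[u1 u2] /andP[v1 v2] uv] ->]]]|[c1 c2]].
  have U1 i := forallP u1 i; have V1 i := forallP v1 i.
  have U2 i k := implyP (forallP (forallP u2 i) k).
  have V2 i k := implyP (forallP (forallP v2 i) k).
  have UV (i j : 'I_m.+1) : (i < j)%N -> ~~ ((j - i <= u i) && (j - i <= v j))%N.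
    move=> ij; apply: contra uv => uvij; apply/existsP; exists i.
    by apply/existsP; exists j; rewrite ij.
  have UV0 (i : 'I_m) := UV (widen_ord (leqnSn m) i) (lift ord0 i).
  have wE (i : 'I_m) : widen_ord (leqnSn m) i = i :> nat by [].
  have lE (i : 'I_m) : lift ord0 i = i.+1 :> nat by [].
  split=> [i|i k ik].
    rewrite ffunE; move: (U1 (widen_ord (leqnSn m) i)) (V1 (lift ord0 i)) (UV0 i).
    by rewrite wE lE; have := ltn_ord i; lia.
  rewrite /nested_pair /compat_pair !ffunE.
  move: (U2 (widen_ord (leqnSn m) i) (widen_ord (leqnSn m) k)).
  move: (V2 (lift ord0 k) (lift ord0 i)).
  move: (UV (widen_ord (leqnSn m) i) (lift ord0 k)) (UV0 i) (UV0 k).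
  by rewrite !wE !lE; lia.
apply/CCP.
pose u (j : 'I_m.+1) :=
  if unlift ord_max j is Some i then if 0 <= c i then `|c i|%N else 0%N else 0%N.
pose v (j : 'I_m.+1) :=
  if unlift ord0 j is Some i then if 0 <= c i then 0%N else `|c i|%N else 0%N.
pose w (i : 'I_m) := widen_ord (leqnSn m) i.
pose l (i : 'I_m) := lift ord0 i.
have wE (i : 'I_m) : w i = i :> nat by [].
have lE (i : 'I_m) : l i = i.+1 :> nat by [].
have wP (j : 'I_m.+1) : j = ord_max \/ exists i, j = w i.
  case: (unliftP ord_max j) => [i|] ->; [right; exists i|by left].
  by apply: val_inj; exact: lift_max.
have lP (j : 'I_m.+1) : j = ord0 \/ exists i, j = l i.
  by case: (unliftP ord0 j) => [i|] ->; [right; exists i|left].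
have uE (i : 'I_m) : u (w i) = if 0 <= c i then `|c i|%N else 0%N.
  have -> : w i = lift ord_max i by apply: val_inj; exact: esym (lift_max i).
  by rewrite /u liftK.
have vE (i : 'I_m) : v (l i) = if 0 <= c i then 0%N else `|c i|%N.
  by rewrite /v liftK.
have uM : u ord_max = 0%N by rewrite /u unlift_none.
have v0 : v ord0 = 0%N by rewrite /v unlift_none.
have maxE : (ord_max : 'I_m.+1) = m :> nat by [].
have zeroE : (ord0 : 'I_m.+1) = 0%N :> nat by [].
have neqn (i k : 'I_m) : i != k -> (i : nat) <> k by move/eqP => ne /val_inj.
have lt_m (i : 'I_m) : (i < m)%N := ltn_ord i.
exists u, v; split; last first.
  have signE (x : int) :
    x = (if 0 <= x then `|x|%N else 0%N)%:Z - (if 0 <= x then 0%N else `|x|%N)%:Z.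
    by case: ifP => ?; lia.
  by apply/ffunP => i; rewrite ffunE uE vE; exact: signE.
clearbody u v w l.
apply/and3P; split; [apply/andP; split|apply/andP; split|].
- apply/forallP => j; have [->|[i ->]] := wP j; first by rewrite uM.
  by rewrite uE wE; move: (c1 i) (lt_m i); case: (lerP 0 (c i)) => ?; lia.
- apply/forallP => j; apply/forallP => k; apply/implyP.
  have [->|[i ->]] := wP j; have [->|[h ->]] := wP k; rewrite ?uM ?maxE //.
    by rewrite wE; have := lt_m h; lia.
  have [<-|/neqn ne] := eqVneq i h; first by rewrite subnn subn0.
  rewrite !uE !wE; move: (c2 i h); rewrite /nested_pair.
  by case: (lerP 0 (c i)) => ?; case: (lerP 0 (c h)) => ?; lia.
- apply/forallP => j; have [->|[i ->]] := lP j; first by rewrite v0.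
  by rewrite vE lE; move: (c1 i) (lt_m i); case: (lerP 0 (c i)) => ?; lia.
- apply/forallP => j; apply/forallP => k; apply/implyP.
  have [->|[i ->]] := lP j; have [->|[h ->]] := lP k; rewrite ?v0 ?zeroE //.
    by rewrite lE; lia.
  have [<-|/neqn ne] := eqVneq i h; first by rewrite subnn subn0.
  rewrite !vE !lE; move: (c2 h i); rewrite /nested_pair.
  by case: (lerP 0 (c i)) => ?; case: (lerP 0 (c h)) => ?; lia.
- apply/existsPn => j; apply/existsPn => k.
  have [->|[i ->]] := wP j; first by rewrite uM maxE; have := ltn_ord k; lia.
  have [->|[h ->]] := lP k; first by rewrite v0 zeroE; lia.
  have [<-|/neqn ne] := eqVneq i h.
    by rewrite uE vE wE lE; case: (lerP 0 (c i)) => ?; lia.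
  rewrite uE vE wE lE; move: (c2 i h); rewrite /compat_pair.
  by case: (lerP 0 (c i)) => ?; case: (lerP 0 (c h)) => ?; lia.
Qed.

(** * Covers and wings *)

Definition setc m (c : {ffun 'I_m -> int}) (i : 'I_m) (t : int) :
    {ffun 'I_m -> int} :=
  [ffun j => if j == i then t else c j].

(** The intermediate stages of the construction of the input-wing b from the
output-wing a. *)
Definition mix m (k : nat) (a b : {ffun 'I_m -> int}) : {ffun 'I_m -> int} :=
  [ffun j : 'I_m => if (j < k)%N then a j else b j].

(** Moving one entry of c towards c' keeps c cubic if the entry is well chosen:
the first differing negative entry, moved no further than 0, and only when
there is none the first differing entry.  Being first protects the conditions
that involve smaller indices, and those with larger indices follow from the
same conditions on c and c', as c lies below c'; giving priority to the negative entries ensures that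
they agree with those of c' when a positive one grows, whence compatibility. *)
Lemma cubic_setc_between m (c c' : {ffun 'I_m -> int}) :
  cubic c -> cubic c' -> cc_le c c' -> c != c' ->
  exists2 i, c i != c' i &
    exists t, [/\ c i < t, t <= c' i & cubic (setc c i t)].
Proof.
move=> [c1 c2] [d1 d2] /forallP le /eqP ne.
have [i0 ne0] : exists i, c i != c' i.
  apply/existsP; rewrite -negb_forall; apply/negP => /forallP eqc.
  by apply: ne; apply/ffunP => i; apply/eqP.
have [/existsP[j1 j1P]|/existsPn noneg] :=
  boolP [exists j : 'I_m, (c j != c' j) && (c j < 0)].
  case: (@arg_minnP _ j1 (fun j => (c j != c' j) && (c j < 0))
    (fun j : 'I_m => j : nat) j1P) => i /andP[nei ci0] imin.
  exists i => //; exists (Num.min (c' i) 0).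
  have {}imin (j : 'I_m) : (j < i)%N -> c j < 0 -> c j = c' j.
    by move=> ji cj; move: (imin j); case: eqVneq => //= _; lia.
  have := le i; split; [lia|lia|split=> [k|k l kl]].
    by rewrite ffunE; case: eqP => [->|_]; move: (c1 k) (c1 i) (d1 i); lia.
  rewrite /nested_pair /compat_pair !ffunE.
  move: (c2 k l kl) (d2 k l kl) (le k) (le l); rewrite /nested_pair /compat_pair.
  case: (eqVneq k i) => [ki|ki]; case: (eqVneq l i) => [li|li]; subst; try lia.
  by move: (imin k kl); lia.
case: (@arg_minnP _ i0 (fun j => c j != c' j) (fun j : 'I_m => j : nat) ne0).
move=> i nei imin; exists i => //; exists (c' i).
have {}imin (j : 'I_m) : (j < i)%N -> c j = c' j.
  by move=> ji; move: (imin j); case: eqVneq => //= _; lia.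
have := le i; have := noneg i; rewrite nei /= => ci0 lei.
split; [lia|lia|split=> [k|k l kl]].
  by rewrite ffunE; case: eqP => [->|_]; move: (c1 k) (d1 i); lia.
have noneg' j : c j < 0 -> c j = c' j.
  by move: (noneg j); case: eqVneq => //= _; lia.
rewrite /nested_pair /compat_pair !ffunE.
move: (c2 k l kl) (d2 k l kl) (le k) (le l) (noneg' l) (noneg' k).
rewrite /nested_pair /compat_pair.
case: (eqVneq k i) => [ki|ki]; case: (eqVneq l i) => [li|li]; subst; try lia.
by move: (imin k kl); lia.
Qed.

Lemma differs_onlyE m (i : 'I_m) (c c' : {ffun 'I_m -> int}) :
  differs_only_at i c c' <-> c' i != c i /\ c' = setc c i (c' i).
Proof.
split=> [/forallP d|[ne ->]].
  split; first by move: (d i); rewrite eqxx eqb_id eq_sym.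
  apply/ffunP => j; rewrite ffunE; case: eqVneq => [->//|ji].
  by move: (d j); rewrite (negbTE ji) eqbF_neg negbK => /eqP.
apply/forallP => j; rewrite ffunE; case: (eqVneq j i) => [->|_].
  by rewrite eqb_id eq_sym.
by rewrite eqxx.
Qed.

(** An edge of the Hasse diagram changes a single entry, since otherwise
[cubic_setc_between] would give an element strictly inside it. *)
Lemma covers_differs m (c c' : {ffun 'I_m -> int}) :
  cc_covers c c' -> exists i, differs_only_at i c c'.
Proof.
case/and5P=> /CC_cubic cC /CC_cubic c'C le ne /hasPn nb.
have [i nei [t [ct tc' tC]]] := cubic_setc_between cC c'C le ne.
have := nb _ (proj2 (CC_cubic _) tC).
have -> : cc_le c (setc c i t).
  by apply/forallP => j; rewrite ffunE; case: eqVneq => // ->; apply: ltW.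
have -> : cc_le (setc c i t) c'.
  by apply/forallP => j; rewrite ffunE; case: eqVneq => [->//|_]; apply: (forallP le).
have /negP : setc c i t != c.
  by apply/eqP => /ffunP/(_ i); rewrite ffunE eqxx => tE; rewrite tE ltxx in ct.
move=> /negP -> /=; rewrite negbK => /eqP <-; exists i; apply/differs_onlyE.
by rewrite ffunE eqxx; split; [lia|].
Qed.

(** A coordinate has at most one cover in each direction i and all its covers
have a direction, so m covers occupy all m directions. *)
Lemma output_wing_up m (c : {ffun 'I_m -> int}) (i : 'I_m) :
  output_wing c -> exists2 t, c i < t & cubic (setc c i t).
Proof.
case/andP => cC /eqP cardS.
set S := [fset c' in CC m | cc_covers c c']%fset in cardS.
pose f (x : S) : 'I_m := odflt i [pick j | differs_only_at j c (fsval x)].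
have covS (x : S) : cc_covers c (fsval x).
  by case: x => x /= xS; move: xS; rewrite !inE /= => /andP[].
have fP x : differs_only_at (f x) c (fsval x).
  rewrite /f; case: pickP => //= nx.
  by have [j] := covers_differs (covS x); rewrite nx.
have f_inj : injective f.
  move=> x y fxy; apply: val_inj.
  by apply: cc_covers_only_uniq (covS x) (fP x) (covS y) _; rewrite fxy; apply: fP.
have onto := inj_card_onto f_inj.
have /onto/(_ i)/codomP[x fx] : (#|'I_m| <= #|{: S}|)%N.
  by rewrite -cardfE cardS card_ord.
have := fP x; rewrite -fx => /differs_onlyE[ne eqx].
have /and5P[_ xC /forallP le _ _] := covS x.
exists (fsval x i); first by rewrite lt_neqAle eq_sym ne le.
by rewrite -eqx; apply/CC_cubic.
Qed.

Lemma up_least m (i : 'I_m) (c c' : {ffun 'I_m -> int}) :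
  up i c = Some c' ->
  [/\ c i < c' i, c' = setc c i (c' i), cubic c' &
      forall t, c i < t -> cubic (setc c i t) -> c' i <= t].
Proof.
move=> /up_SomeP[/and5P[_ /CC_cubic c'C /forallP le _ /hasPn nb]].
move=> /differs_onlyE[ne eqc']; split=> //; first by rewrite lt_neqAle eq_sym ne le.
move=> t ct tC; rewrite leNgt; apply/negP => tc'.
have := nb _ (proj2 (CC_cubic _) tC); rewrite !negb_and !negbK; case/or4P.
- move/negP; apply; apply/forallP => j.
  by rewrite ffunE; case: (eqVneq j i) => // ->; apply: ltW.
- move/negP; apply; apply/forallP => j.
  by rewrite ffunE; case: (eqVneq j i) => [->|_]; [apply: ltW|apply: le].
- by move=> /eqP/ffunP/(_ i); rewrite ffunE eqxx => tE; rewrite tE ltxx in ct.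
- by move=> /eqP/ffunP/(_ i); rewrite ffunE eqxx => tE; rewrite tE ltxx in tc'.
Qed.

(** The i-th step only changes the i-th entry, so its source and its target can
be read off from the two ends a and b. *)
Lemma up_foldr_steps m (a b : {ffun 'I_m -> int}) (s : seq 'I_m) :
  sorted (fun i j : 'I_m => (i < j)%N) s ->
  foldr (fun i oc => obind (up i) oc) (Some a) s = Some b ->
  (forall j, j \notin s -> b j = a j) /\
  (forall i, i \in s -> up i (mix i.+1 a b) = Some (mix i a b)).
Proof.
elim: s b => [|i s IH] b /= s_sorted; first by case=> ->.
have lt_s : all (fun j : 'I_m => (i < j)%N) s.
  by apply: order_path_min s_sorted => x y z; apply: ltn_trans.
case E: (foldr _ _ s) => [b'|//] /= upb.
have [off on] := IH b' (path_sorted s_sorted) E.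
have [_ bE _ _] := up_least upb.
have bE' j : j != i -> b j = b' j by move=> ji; rewrite bE ffunE (negbTE ji).
have notin_s (j : 'I_m) : (j <= i)%N -> j \notin s.
  by move=> ji; apply/negP => /(allP lt_s); rewrite ltnNge ji.
split=> [j|j].
  by rewrite inE negb_or => /andP[ji js]; rewrite bE' // off.
rewrite inE => /predU1P[->|js].
  have -> : mix i.+1 a b = b'.
    apply/ffunP => k; rewrite ffunE ltnS; case: leqP => ki.
      by rewrite off // notin_s.
    by rewrite bE' // -val_eqE /=; lia.
  rewrite upb; congr Some; apply/ffunP => k; rewrite ffunE; case: ltnP => // ki.
  by rewrite bE' ?off ?notin_s // -?val_eqE /=; lia.
have ij : (i < j)%N := allP lt_s _ js.
have mixE k : (i < k)%N -> mix k a b = mix k a b'.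
  move=> ik; apply/ffunP => l; rewrite !ffunE; case: ltnP => // kl.
  by rewrite bE' // -val_eqE /=; lia.
by rewrite !mixE //; [apply: on|lia].
Qed.

(** What the rest of the proof uses of a cell-wing: [wing_mixC] and [wing_min]
describe the successive increases leading from a to b, [wing_up] says that a is
an output-wing. *)
Record wing_pair m (a b : {ffun 'I_m -> int}) : Prop := WingPair {
  wing_lt : forall i, a i < b i;
  wing_mixC : forall k, cubic (mix k a b);
  wing_min : forall (i : 'I_m) t,
    a i < t -> cubic (setc (mix i a b) i t) -> b i <= t;
  wing_up : forall i, exists2 t, a i < t & cubic (setc a i t) }.

Lemma cell_wing_pair m (a b : {ffun 'I_m -> int}) :
  cell_wing a b -> wing_pair a b.
Proof.
case=> /and3P[/CC_cubic aC /CC_cubic bC _] outa ina.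
have [] := up_foldr_steps _ ina.
  have -> : sorted (fun i j : 'I_m => (i < j)%N) (enum 'I_m) =
            sorted ltn (map val (enum 'I_m)) by rewrite sorted_map.
  by rewrite val_enum_ord iota_ltn_sorted.
move=> _ steps.
have {}steps i := up_least (steps i (mem_enum _ i)).
split=> [i|k|i t at0 tC|i].
- by case: (steps i) => + _ _ _; rewrite !ffunE ltnSn ltnn.
- have [km|mk] := ltnP k m; first by case: (steps (Ordinal km)).
  have -> // : mix k a b = a.
  by apply/ffunP => j; rewrite ffunE (leq_trans (ltn_ord j) mk).
- case: (steps i) => _ _ _ /(_ t); rewrite !ffunE ltnSn ltnn; apply=> //.
  have -> // : setc (mix i.+1 a b) i t = setc (mix i a b) i t.
  apply/ffunP => j; rewrite !ffunE; case: (eqVneq j i) => // ji.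
  by rewrite ltnS leq_eqVlt (negbTE (ji : (j : nat) != i)).
- exact: output_wing_up.
Qed.

(** A shorter interval is still compatible with the others and still contained
in those that contained the longer one; what remains to be checked is that it
contains those of the indices that it covers. *)
Lemma cubic_shrink m (c : {ffun 'I_m -> int}) (i : 'I_m) (t : int) :
  cubic c -> 0 <= t <= c i \/ c i <= t <= 0 ->
  (forall k : 'I_m, (i < k)%N ->
     k%:Z <= i%:Z + t -> k%:Z + c k <= i%:Z + t) ->
  (forall k : 'I_m, (k < i)%N ->
     i%:Z + t <= k%:Z -> i%:Z + t <= k%:Z + c k) ->
  cubic (setc c i t).
Proof.
move=> [c1 c2] ti up_t dn_t; split=> [k|k l kl].
  rewrite ffunE; case: (eqVneq k i) => [->|_]; last exact: c1.
  by move: (c1 i) (ltn_ord i); lia.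
move: (c2 k l kl); rewrite /nested_pair /compat_pair !ffunE.
case: (eqVneq k i) => [ki|ki]; case: (eqVneq l i) => [li|li]; subst; try lia.
  by move: (up_t l kl); lia.
by move: (dn_t k kl); lia.
Qed.

(** * The coordinate Gamma of a wing pair *)

Section Wing.
Variables (m : nat) (a b : {ffun 'I_m -> int}).
Hypothesis w : wing_pair a b.

Lemma wing_outC : cubic a.
Proof.
have <- : mix m a b = a by apply/ffunP => j; rewrite ffunE ltn_ord.
exact: wing_mixC.
Qed.

Lemma wing_inC : cubic b.
Proof.
have <- : mix 0 a b = b by apply/ffunP => j; rewrite ffunE.
exact: wing_mixC.
Qed.

(** Setting an entry to 0 is always possible, so a step cannot jump over 0. *)
Lemma wing_in_le0 (i : 'I_m) : a i < 0 -> b i <= 0.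
Proof.
move=> ai; apply: (wing_min w) => //.
apply: cubic_shrink; [exact: (wing_mixC w)|lia|move=> k; lia|move=> k; lia].
Qed.

(** T0 is pushed to the right just enough to contain the intervals of b that
start at indices in (i, T0]; by nesting one round suffices. *)
Lemma stable_reach (i : 'I_m) (T0 : int) :
  exists T, [/\ T0 <= T,
    forall k : 'I_m, (i < k)%N -> k%:Z <= T0 -> k%:Z + b k <= T &
    T = T0 \/ exists k : 'I_m, [/\ (i < k)%N, k%:Z <= T0 & T = k%:Z + b k]].
Proof.
have [/existsP[k0 k0P]|/existsPn none] :=
  boolP [exists k : 'I_m, [&& (i < k)%N, k%:Z <= T0 & T0 < k%:Z + b k]].
  case: (@arg_maxP _ _ _ k0 (fun k : 'I_m => [&& (i < k)%N, k%:Z <= T0 & T0 < k%:Z + b k])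
          (fun k : 'I_m => k%:Z + b k) k0P) => k /and3P[ik kT0 kT] kmax.
  exists (k%:Z + b k); split; [exact: ltW| |by right; exists k].
  move=> l il lT0; move: (kmax l); rewrite il lT0 /=.
  by case: ltP => [_ /(_ isT)//|]; lia.
by exists T0; split=> // [k ik kT0|]; [move: (none k); lia|left].
Qed.

(** By downward induction on i.  When a_i is nonnegative, [wing_up] gives an
increase of a_i reaching to T0 = i + y; pushed to T by [stable_reach], it is a
possible value for the i-th step, so i + b_i <= T.  An index k whose
negative entry in a extends to the left of i is not passed by T0, since the
increase of a is compatible, nor by the intervals of b starting before it, by
induction; so T does not exceed k. *)
Lemma wing_compat (i k : 'I_m) :
  (i < k)%N -> ~ (k%:Z < i%:Z + b i /\ k%:Z + a k < i%:Z).
Proof.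
have [n] := ubnP (m - i)%N.
elim: n i k => // n IH i k lt_n ik [kb ka].
have ai : 0 <= a i by move: (@wing_in_le0 i); lia.
have [b1 b2] := wing_inC.
have [m1 m2] := wing_mixC w i.
have [y ay [y1 y2]] := wing_up w i.
have [T [T0T maxT T_eq]] := stable_reach i (i%:Z + y).
have T_le (l : 'I_m) : (i < l)%N -> l%:Z + a l < i%:Z -> T <= l%:Z.
  move=> il al.
  have T0l : i%:Z + y <= l%:Z.
    move: (y2 i l il); rewrite /compat_pair !ffunE eqxx.
    by case: (eqVneq l i) => [li|_]; [move: il; rewrite li ltnn|lia].
  case: T_eq => [->//|[h [ih hT0 TE]]].
  have [hl|lh] := ltnP h l.
    have := @IH h l _ hl; have := ltn_ord i; have := ltn_ord h; lia.
  (* The interval of b at l itself is excluded, as b_l <= 0. *)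
  have lE : l = h by apply: val_inj => /=; lia.
  by subst l; move: (@wing_in_le0 h); lia.
(* By minimality of the i-th step i + b_i <= T, and T <= k contradicts kb. *)
suff TC : cubic (setc (mix i a b) i (T - i%:Z)).
  have := wing_min w _ TC; have := T_le k ik ka; lia.
have lt_b := wing_lt w.
split=> [j|h l hl].
  rewrite ffunE; case: (eqVneq j i) => [->|_]; last exact: m1.
  case: T_eq => [->|[h [_ _ ->]]]; last by move: (b1 h); lia.
  by move: (y1 i); rewrite ffunE eqxx; lia.
rewrite /nested_pair /compat_pair [setc _ _ _ h]ffunE [setc _ _ _ l]ffunE.
case: (eqVneq h i) => [hi|hi]; case: (eqVneq l i) => [li|li].
- by subst h l; rewrite ltnn in hl.
- subst h; rewrite ffunE ltnNge (ltnW hl) /=.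
  have := maxT l hl; have := T_le l hl; have := lt_b l.
  case: T_eq => [->|[h [ih hT0 TE]]]; first by move: (@wing_in_le0 l); lia.
  have [hl'|lh] := ltnP h l; last by move: (@wing_in_le0 l); lia.
  by move: (b2 h l hl') (@wing_in_le0 l); rewrite /nested_pair; lia.
- subst l; rewrite ffunE hl.
  move: (y2 h i hl); rewrite /nested_pair /compat_pair !ffunE eqxx (negbTE hi).
  case: T_eq => [->|[k' [ik' kT0 TE]]]; first by lia.
  move: (m2 h k'); rewrite /nested_pair !ffunE hl [(k' < i)%N]ltnNge (ltnW ik') /=.
  by lia.
- exact: m2.
Qed.

Let G := Gamma a b.

Lemma GammaE (i : 'I_m) : G i = if a i < 0 then a i else b i.
Proof. by rewrite ffunE. Qed.

(** The positive part of Gamma is that of b and its negative part is that of a,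
which leaves only their compatibility to be proved. *)
Lemma Gamma_cubic : cubic G.
Proof.
have [a1 a2] := wing_outC; have [b1 b2] := wing_inC; have lt_b := wing_lt w.
split=> [i|i k ik]; first by rewrite GammaE; case: ifP.
rewrite /nested_pair /compat_pair !GammaE.
move: (a2 i k ik) (b2 i k ik) (wing_compat ik) (lt_b i) (lt_b k).
rewrite /nested_pair /compat_pair.
by case: (ltrP (a i) 0) => ?; case: (ltrP (a k) 0) => ?; lia.
Qed.

Lemma Gamma_neq0 (i : 'I_m) : G i != 0.
Proof. by rewrite GammaE; move: (wing_lt w i); case: (ltrP (a i) 0); lia. Qed.

(** The entry of d at an index where a is nonnegative is a possible value for
the step from a_i to b_i, once the later entries of d agree with b; minimality
of the step then forces b_i <= d_i.  At a negative entry of a, if d_i were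
different from a_i it would be a possible value strictly before b_i, once the
earlier negative entries of d agree with a, against the minimality of b_i. *)
Lemma Gamma_unique (d : {ffun 'I_m -> int}) :
  cubic d ->
  (forall i, (a i < 0 -> a i <= d i < b i) /\ (0 <= a i -> a i < d i <= b i)) ->
  d = G.
Proof.
move=> [d1 d2] box; have lt_b := wing_lt w; have [a1 a2] := wing_outC.
have pos (i : 'I_m) : 0 <= a i -> b i <= d i.
  have [n] := ubnP (m - i)%N; elim: n i => // n IH i lt_n ai.
  have boxi := box i; have [m1 m2] := wing_mixC w i.
  apply: (wing_min w); first by lia.
  split=> [j|h l hl].
    by rewrite ffunE; case: (eqVneq j i) => [->|_]; [apply: d1|apply: m1].
  rewrite /nested_pair /compat_pair [setc _ _ _ h]ffunE [setc _ _ _ l]ffunE.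
  case: (eqVneq h i) => [hi|hi]; case: (eqVneq l i) => [li|li].
  + by subst h l; rewrite ltnn in hl.
  + subst h; rewrite ffunE ltnNge (ltnW hl) /=.
    move: (d2 i l hl) (box l) (@wing_in_le0 l) (IH l) (lt_b l) (ltn_ord l).
    by rewrite /nested_pair /compat_pair; lia.
  + subst l; rewrite ffunE hl.
    by move: (m2 h i hl); rewrite /nested_pair /compat_pair !ffunE hl ltnn; lia.
  + exact: m2.
have neg (p : 'I_m) : a p < 0 -> d p = a p.
  have [n] := ubnP p; elim: n p => // n IH p lt_n ap.
  have boxp := box p; have [m1 m2] := wing_mixC w p.
  have [s1 s2] := wing_mixC w p.+1.
  have [//|ad] := eqVneq (d p) (a p).
  suff /(wing_min w) : cubic (setc (mix p a b) p (d p)) by lia.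
  split=> [j|h l hl].
    by rewrite ffunE; case: (eqVneq j p) => [->|_]; [apply: d1|apply: m1].
  rewrite /nested_pair /compat_pair [setc _ _ _ h]ffunE [setc _ _ _ l]ffunE.
  case: (eqVneq h p) => [hp|hp]; case: (eqVneq l p) => [lp|lp].
  + by subst h l; rewrite ltnn in hl.
  + subst h; rewrite ffunE ltnNge (ltnW hl) /=.
    move: (s2 p l hl) (@wing_in_le0 p); rewrite /nested_pair !ffunE ltnSn ltnS leqNgt hl /=.
    by lia.
  + subst l; rewrite ffunE hl; move: (a2 h p hl) (d2 h p hl) (IH h) (@wing_in_le0 p).
    by rewrite /nested_pair /compat_pair; lia.
  + exact: m2.
have dE (i : 'I_m) : d i = if a i < 0 then a i else b i.
  move: (box i) (pos i) (neg i).
  by case: (ltrP (a i) 0) => ?; lia.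
by apply/ffunP => i; rewrite GammaE; exact: dE.
Qed.

(** The intervals that the new i-th interval has to contain are those of a stage
of the construction: if a_i < 0 their indices are less than i, where stage i
has the entries of a; otherwise they are greater than i, where stage i + 1 has
the entries of b. *)
Lemma Gamma_shrink (i : 'I_m) : cubic (setc G i (if a i < 0 then b i else a i)).
Proof.
have lt_b := wing_lt w; have [m1 m2] := wing_mixC w i.
have [s1 s2] := wing_mixC w i.+1.
apply: cubic_shrink => [||k ik|k ki]; first exact: Gamma_cubic.
- by rewrite GammaE; move: (lt_b i) (@wing_in_le0 i); case: (ltrP (a i) 0); lia.
- rewrite GammaE; move: (s2 i k ik) (@wing_in_le0 i).
  rewrite /nested_pair !ffunE ltnSn ltnS leqNgt ik /=.
  by case: (ltrP (a i) 0) => ?; case: (ltrP (a k) 0) => ?; lia.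
- rewrite GammaE; move: (m2 k i ki) (lt_b k).
  rewrite /nested_pair !ffunE ki ltnn /=.
  by case: (ltrP (a i) 0) => ?; case: (ltrP (a k) 0) => ?; lia.
Qed.

End Wing.

(** * Synchronized volume as a number of unit cubes *)

Lemma SCCP m (c : {ffun 'I_m -> int}) :
  c \in SCC m <-> cubic c /\ forall i, c i != 0.
Proof.
rewrite !inE; split=> [/andP[/CC_cubic cC /forallP]|[/CC_cubic cC c0]] //.
by rewrite cC; apply/forallP.
Qed.

(** A unit cube of the box between 0 and c is encoded by the absolute values x_i
of its corner next to the origin, the signs being those of c; letters x_i < m
suffice because the entries of cubic coordinates are at most m in absolute
value. *)
Definition below m (c : {ffun 'I_m -> int}) (x : {ffun 'I_m -> 'I_m}) : bool :=
  [forall i, (x i < `|c i|)%N].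

Definition own_cells m (c : {ffun 'I_m -> int}) : {set {ffun 'I_m -> 'I_m}} :=
  [set x | below c x &&
    all (fun d => scc_le d c ==> below d x ==> (d == c)) (SCC m)].

Lemma scc_lexx m (c : {ffun 'I_m -> int}) : scc_le c c.
Proof. by apply/forallP => i; rewrite eqxx lexx. Qed.

Lemma scc_le_trans m (c d e : {ffun 'I_m -> int}) :
  scc_le c d -> scc_le d e -> scc_le c e.
Proof.
move=> /forallP cd /forallP de; apply/forallP => i.
by move: (cd i) (de i) => /andP[/eqP -> cd'] /andP[-> de']; apply: le_trans de'.
Qed.

Definition scc_meet m (c d : {ffun 'I_m -> int}) : {ffun 'I_m -> int} :=
  [ffun i => if `|c i| <= `|d i| then c i else d i].

Lemma scc_meet_le m (c d : {ffun 'I_m -> int}) :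
  (forall i, sgz (c i) = sgz (d i)) ->
  scc_le (scc_meet c d) c /\ scc_le (scc_meet c d) d.
Proof.
move=> sg; split; apply/forallP => i; rewrite ffunE; case: (lerP `|c i| `|d i|).
- by rewrite eqxx lexx.
- by rewrite sg eqxx => /ltW.
- by rewrite sg eqxx.
- by rewrite eqxx lexx.
Qed.

(** The shorter of two intervals at i contains the shorter of the two at any
index that it covers, and shortening preserves compatibility. *)
Lemma scc_meetP m (c d : {ffun 'I_m -> int}) :
  (forall i, sgz (c i) = sgz (d i)) -> c \in SCC m -> d \in SCC m ->
  scc_meet c d \in SCC m.
Proof.
move=> sg /SCCP[[c1 c2] c0] /SCCP[[d1 d2] d0]; apply/SCCP; split; last first.
  by move=> i; rewrite ffunE; case: ifP.
have sgP (i : 'I_m) : (0 < c i /\ 0 < d i) \/ (c i < 0 /\ d i < 0).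
  by move: (sg i) (c0 i) (d0 i); case: (sgzP (c i)); case: (sgzP (d i)); lia.
split=> [i|i k ik]; first by rewrite ffunE; case: ifP => _; [apply: c1|apply: d1].
rewrite /nested_pair /compat_pair !ffunE.
move: (c2 i k ik) (d2 i k ik) (sgP i) (sgP k).
rewrite /nested_pair /compat_pair.
by case: (lerP `|c i| `|d i|) => ?; case: (lerP `|c k| `|d k|) => ?; lia.
Qed.

Lemma own_cells_uniq m (c d1 d2 : {ffun 'I_m -> int}) x :
  d1 \in SCC m -> d2 \in SCC m -> scc_le d1 c -> scc_le d2 c ->
  x \in own_cells d1 -> x \in own_cells d2 -> d1 = d2.
Proof.
move=> s1 s2 /forallP le1 /forallP le2.
rewrite !inE => /andP[/forallP b1 /allP m1] /andP[/forallP b2 /allP m2].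
have sg i : sgz (d1 i) = sgz (d2 i).
  by move: (le1 i) (le2 i) => /andP[/eqP -> _] /andP[/eqP -> _].
have [l1 l2] := scc_meet_le sg.
have b : below (scc_meet d1 d2) x by apply/forallP => i; rewrite ffunE; case: ifP.
have ms := scc_meetP sg s1 s2.
move: (m1 _ ms) (m2 _ ms); rewrite l1 l2 b /=.
by move=> /eqP e1 /eqP e2; exact: etrans (esym e1) e2.
Qed.

(** A cube not in [own_cells c] belongs to a smaller box: descend. *)
Lemma own_cells_exists m (c : {ffun 'I_m -> int}) x :
  c \in SCC m -> below c x ->
  exists d, [/\ d \in SCC m, scc_le d c & x \in own_cells d].
Proof.
have [n] := ubnP (absz_sum c); elim: n c => // n IH c lt_n cS bc.
have [xc|] := boolP (x \in own_cells c); first by exists c; rewrite scc_lexx.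
rewrite inE bc /= => /allPn[d dS]; rewrite !negb_imply => /and3P[dc bd ne].
have [|e [eS ed xe]] := IH d _ dS bd.
  by apply: leq_trans (scc_lt_absz_sum dc ne) _.
by exists e; split=> //; apply: scc_le_trans dc.
Qed.

Lemma card_box m (lo hi : 'I_m -> nat) :
  (forall i, (hi i <= m)%N) ->
  #|[set x : {ffun 'I_m -> 'I_m} | [forall i, lo i <= x i < hi i]%N]| =
  (\prod_i (hi i - lo i))%N.
Proof.
move=> him.
pose F i : pred 'I_m := fun y => (lo i <= y < hi i)%N.
have -> : #|[set x : {ffun 'I_m -> 'I_m} | [forall i, lo i <= x i < hi i]%N]| =
          #|family F|.
  apply: eq_card => x; rewrite inE; apply/forallP/familyP => h i;
  by move: (h i); rewrite ?inE.
rewrite card_family foldrE big_map -big_enum /=; apply: eq_bigr => i _.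
rewrite -sum1_card.
transitivity (\sum_(lo i <= j < hi i) 1)%N; last by rewrite sum_nat_const_nat muln1.
rewrite (big_nat_widenl _ 0) // (big_nat_widen _ _ m) ?him // big_mkord.
by apply: eq_bigl => j; rewrite unfold_in /= andbC.
Qed.

Lemma cubic_absz_le m (c : {ffun 'I_m -> int}) (i : 'I_m) :
  cubic c -> (`|c i| <= m)%N.
Proof. by case=> /(_ i); have := ltn_ord i; lia. Qed.

Lemma vol_card m (c : {ffun 'I_m -> int}) :
  cubic c -> vol c = #|[set x | below c x]|%:Z.
Proof.
move=> cC; transitivity (\prod_i (`|c i|%N - 0)%N%:Z).
  by apply: eq_bigr => i _; rewrite subn0 abszE.
rewrite -(big_morph Posz PoszM (erefl _)) -card_box; last first.
  by move=> i; apply: cubic_absz_le.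
by congr Posz; apply: eq_card => x; rewrite !inE.
Qed.

(** The sets [own_cells d], for d below c, partition the cubes of the box of c. *)
Lemma sum_own_cells m (c : {ffun 'I_m -> int}) :
  c \in SCC m ->
  \sum_(d <- SCC m | scc_le d c) #|own_cells d|%:Z = vol c.
Proof.
move=> cS; have [cC _] := proj1 (SCCP c) cS.
have cardE (A : {set {ffun 'I_m -> 'I_m}}) : #|A|%:Z = \sum_x (x \in A)%:Z.
  rewrite -sum1_card (big_morph Posz PoszD (erefl _)) big_mkcond.
  by apply: eq_bigr => x _; case: ifP.
rewrite (vol_card cC) cardE (eq_bigr _ (fun d _ => cardE (own_cells d))).
rewrite exchange_big /=; apply: eq_bigr => x _; rewrite inE.
case: (boolP (below c x)) => bx.
  have [d [dS dc xd]] := own_cells_exists cS bx.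
  rewrite big_mkcond (bigD1_seq d) ?fset_uniq //= dc xd big1_seq ?addr0 //.
  move=> e /andP[ne eS]; case: ifP => // ec; case: (boolP (x \in _)) => // xe.
  by case/eqP: ne; apply: own_cells_uniq ec dc xe xd.
rewrite big1_seq // => d /andP[/forallP dc dS]; case: (boolP (x \in _)) => //.
rewrite inE => /andP[/forallP bd _]; case/negP: bx; apply/forallP => i.
by apply: leq_trans (bd i) _; case/andP: (dc i) => _; lia.
Qed.

Lemma sv_card m (c : {ffun 'I_m -> int}) :
  c \in SCC m -> sv c = #|own_cells c|%:Z.
Proof.
have [n] := ubnP (absz_sum c); elim: n c => // n IH c lt_n cS.
rewrite svE -(sum_own_cells cS); apply/eqP; rewrite subr_eq; apply/eqP.
rewrite (bigID (pred1 c)) /=; congr (_ + _).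
  rewrite big_mkcond (bigD1_seq c) ?fset_uniq //= scc_lexx eqxx big1_seq ?addr0 //.
  by move=> d /andP[/negbTE -> _]; rewrite andbF.
rewrite big_seq_cond [RHS]big_seq_cond; apply: eq_bigr => d /and3P[dS dc ne].
by rewrite IH //; apply: leq_trans (scc_lt_absz_sum dc ne) _.
Qed.

(** A cube x has its outer corner at the distances x_i + 1 from the coordinate
hyperplanes, hence the weak lower bounds: the outer corner must be strictly
beyond the end of the cell-wing that is next to the origin. *)
Lemma own_cells_Gamma m (a b : {ffun 'I_m -> int}) :
  wing_pair a b ->
  own_cells (Gamma a b) =
  [set x : {ffun 'I_m -> 'I_m} |
    [forall i, (if (a i < 0)%R then `|b i| else `|a i|)%N <= x i
                < `|Gamma a b i|]%N].
Proof.
move=> w; have lt_b := wing_lt w; have neg := @wing_in_le0 _ _ _ w.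
have GS : Gamma a b \in SCC m.
  by apply/SCCP; split=> [|i]; [exact: Gamma_cubic|exact: Gamma_neq0].
have GE := GammaE a b.
apply/setP => x; rewrite !inE; apply/andP/forallP => [[/forallP bx /allP own] i|box].
  rewrite bx andbT leqNgt; apply/negP => xi.
  pose d := setc (Gamma a b) i (if a i < 0 then b i else a i).
  have dE (j : 'I_m) : d j = if j == i then if a i < 0 then b i else a i
                             else Gamma a b j by rewrite ffunE.
  have di_lt : scc_le d (Gamma a b).
    apply/forallP => j; rewrite dE; case: (eqVneq j i) => [->|_]; last by rewrite eqxx lexx.
    rewrite GE; move: xi (lt_b i) (neg i).
    case: (ltrP (a i) 0) => ai xi lti bi.
      by rewrite !ltr0_sgz ?eqxx //=; lia.
    by rewrite !gtr0_sgz ?eqxx //=; lia.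
  have bd : below d x.
    apply/forallP => j; rewrite dE; case: (eqVneq j i) => [->|_]; last exact: bx.
    by move: xi; case: ifP.
  have dS : d \in SCC m.
    apply/SCCP; split=> [|j]; first exact: Gamma_shrink.
    rewrite dE; case: ifP => _; last exact: Gamma_neq0.
    by move: xi; case: ifP; lia.
  move: (own d dS); rewrite di_lt bd /= => /eqP/ffunP/(_ i).
  rewrite dE eqxx GE; move: (lt_b i) => /[swap]; case: ifP => _ ->; by rewrite ltxx.
split; first by apply/forallP => i; case/andP: (box i).
suff uniq_d (d : {ffun 'I_m -> int}) :
    d \in SCC m -> scc_le d (Gamma a b) -> below d x -> d = Gamma a b.
  apply/allP => d dS; apply/implyP => dG; apply/implyP => bd.
  by apply/eqP; apply: uniq_d.
move=> /SCCP[dC d0] /forallP dG /forallP bd; apply: (Gamma_unique w dC) => i.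
move: (box i) (dG i) (bd i) (lt_b i) (neg i) (d0 i); rewrite GE.
case: (ltrP (a i) 0) => ai /andP[lo hi] /andP[/eqP sg le] lt_x ltb bi di.
  by move: sg; rewrite (ltr0_sgz ai); case: (sgzP (d i)) => //; lia.
by move: sg; rewrite [sgz (b i)]gtr0_sgz; [case: (sgzP (d i)) => //; lia|lia].
Qed.

(** * Volume of a cell-wing *)

Theorem proposition3p4p4 (m : nat) (cout cin : {ffun 'I_m -> int}) :
  cell_wing cout cin ->
  cell_dim cout cin = m ->
  cell_vol cout cin = sv (Gamma cout cin).
Proof.
move=> /cell_wing_pair w _.
have GC := Gamma_cubic w.
rewrite sv_card; last by apply/SCCP; split=> // i; exact: Gamma_neq0.
rewrite (own_cells_Gamma w) card_box; last by move=> i; exact: cubic_absz_le.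
rewrite (big_morph Posz PoszM (erefl _)); apply: eq_bigr => i _.
rewrite GammaE; move: (wing_lt w i) (@wing_in_le0 _ _ _ w i).
by case: (ltrP (cout i) 0) => ?; lia.
Qed.
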